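(* Let $d=2$ or $d=3$ and let $A\in PL_d$. Then either $A$ is a periodic matrix (i.e. there is an integer $n\ge 1$ with $A^{n+1}=A$) or $A^2$ is a row PLM (i.e. $A^2=R_m^{(d)}$ for some $1\le m\le d$).
   Context: Matrices have entries in a field $k$ of characteristic $0$. A $d\times d$ matrix is a Permutation-Like Matrix (PLM) if all its entries are $0$ or $1$ and each column contains exactly one entry equal to $1$; $PL_d$ is the set of all $d\times d$ PLM. For $1\le m\le d$, $R_m^{(d)}$ is the $d\times d$ matrix whose $m$-th row consists of $1$s and all of whose other entries are $0$; these matrices are called row PLM. *)

(* Defs.v *)
From mathcomp Require Import all_boot all_order all_algebra.
Set Implicit Arguments.
Unset Strict Implicit.
Unset Printing Implicit Defensive.
Import GRing.Theory.
Local Open Scope ring_scope.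

(* Permutation-Like Matrices: a Prop-valued membership predicate for PL_d. *)
Definition PLM (k : fieldType) (d : nat) (A : 'M[k]_d) : Prop :=
  (forall i j : 'I_d, A i j = 0 \/ A i j = 1) /\
  (forall j : 'I_d, exists! i : 'I_d, A i j = 1).

(* Rows are indexed from 0 by 'I_d, so the R_m with 1 <= m <= d
   of the mathematical text is row_PLM k (m - 1). *)
Definition row_PLM (k : fieldType) (d : nat) (m : 'I_d) : 'M[k]_d :=
  \matrix_(i, j) (if i == m then 1 else 0).

Arguments row_PLM k {d} m.

Definition is_row_PLM (k : fieldType) (d : nat) (A : 'M[k]_d) : Prop :=
  exists m : 'I_d, A = row_PLM k m.

Definition periodic_mx (k : fieldType) (d : nat) (A : 'M[k]_d) : Prop :=
  exists n : nat, (1 <= n)%N /\ A ^+ n.+1 = A.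

(* Main.v *)
Require Import Defs.
From mathcomp Require Import all_boot all_order all_algebra.
Set Implicit Arguments.
Unset Strict Implicit.
Unset Printing Implicit Defensive.
Import GRing.Theory.
Local Open Scope ring_scope.

(** A PLM is the matrix of a self-map [f] of the index set, and its powers are
    the matrices of the iterates of [f]. If [f] is injective on its image, it
    permutes the image and is therefore periodic. Otherwise [f] is not
    injective, so the cardinals of the index set (at most 3), of the image of
    [f] and of the image of [f \o f] are strictly decreasing, and [f \o f] is
    constant. *)

Lemma iter_codom_periodic (T : finType) (f : T -> T) :
  {in codom f &, injective f} -> iter (#|T|`!).+1 f =1 f.
Proof.
move=> f_inj x; rewrite iterSr.
have f_stable : {homo f : y / y \in codom f} by move=> y _; apply: codom_f.
have order_dvd : (order f (f x) %| #|T|`!)%N.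
  by apply: dvdn_fact; rewrite order_gt0 max_card.
have /dvdnP[q ->] := order_dvd.
elim: q => // q IHq.
by rewrite mulSn addnC iterD (iter_order_in f_stable f_inj) ?codom_f.
Qed.

Lemma codom_inj_or_comp_constant (T : finType) (f : T -> T) :
  (#|T| <= 3)%N ->
  {in codom f &, injective f} \/ (forall x y, f (f x) = f (f y)).
Proof.
move=> leT3; set S := [set f x | x : T].
have fS x : f x \in S by apply: imset_f.
have [/imset_injP f_inj|ltS] := boolP (#|f @: S| == #|S|).
  left=> _ _ /codomP[x ->] /codomP[y ->]; exact: f_inj.
right=> x y; have ltfS : (#|f @: S| < #|S|)%N.
  by rewrite ltn_neqAle ltS leq_imset_card.
have ltST : (#|S| < #|T|)%N.
  rewrite ltn_neqAle (leq_imset_card f T) andbT.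
  (* If [S] were as large as [T], [f] would be injective, hence injective on [S], against [ltS]. *)
  apply: contra ltS => /imset_injP f_inj.
  by rewrite card_in_imset // => u v _ _; apply: f_inj.
have le1 : (#|f @: S| <= 1)%N.
  by rewrite -ltnS -ltnS (leq_trans _ leT3) // (leq_trans _ ltST) // ltnS.
by apply: (card_le1_eqP le1); apply: imset_f.
Qed.

(** The argument of [f] indexes columns, so that matrix products match compositions in the same
    order. *)
Definition fun_mx (k : fieldType) (d : nat) (f : 'I_d -> 'I_d) : 'M[k]_d :=
  \matrix_(i, j) (i == f j)%:R.
Arguments fun_mx k {d} f.

Lemma eq_fun_mx (k : fieldType) (d : nat) (f g : 'I_d -> 'I_d) :
  f =1 g -> fun_mx k f = fun_mx k g.
Proof. by move=> fg; apply/matrixP => i j; rewrite !mxE fg. Qed.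

Lemma fun_mxX (k : fieldType) (d : nat) (f : 'I_d -> 'I_d) (n : nat) :
  fun_mx k f ^+ n = fun_mx k (iter n f).
Proof.
elim: n => [|n IHn]; first by apply/matrixP => i j; rewrite !mxE.
rewrite exprS IHn; apply/matrixP => i j; rewrite !mxE.
rewrite (bigD1 (iter n f j)) //= !mxE eqxx mulr1 big1 ?addr0 // => l ne_l.
by rewrite !mxE (negPf ne_l) mulr0.
Qed.

Lemma PLM_fun_mx (k : fieldType) (d : nat) (A : 'M[k]_d) :
  PLM A -> exists f : 'I_d -> 'I_d, A = fun_mx k f.
Proof.
move=> [A01 A1].
(* The boolean form lets [xchoose] pick the row of the 1 in each column. *)
have ex1 j : exists i, A i j == 1 by have [i [/eqP]] := A1 j; exists i.
exists (fun j => xchoose (ex1 j)); apply/matrixP => i j; rewrite mxE.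
have /eqP A1j := xchooseP (ex1 j).
case: eqP => [-> //|ne_i]; case: (A01 i j) => // Aij1.
have [l [_ l_uniq]] := A1 j.
by case: ne_i; rewrite -(l_uniq _ Aij1) -(l_uniq _ A1j).
Qed.

Theorem proposition4p1 (k : fieldType) (char0 : [pchar k] =i pred0)
  (d : nat) (hd : d = 2%N \/ d = 3%N) (A : 'M[k]_d) (hA : PLM A) :
  periodic_mx A \/ is_row_PLM (A ^+ 2).
Proof.
have [f ->] := PLM_fun_mx hA.
have led3 : (#|'I_d| <= 3)%N by rewrite card_ord; case: hd => ->.
have [f_inj|f2_const] := codom_inj_or_comp_constant f led3.
  left; exists #|'I_d|`!; rewrite fact_gt0; split=> //.
  rewrite fun_mxX; apply: eq_fun_mx; exact: iter_codom_periodic.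
have d_gt0 : (0 < d)%N by case: hd => ->.
(* Any index serves to name the constant value of [f \o f], which is the row of 1s. *)
pose j0 := Ordinal d_gt0.
right; exists (f (f j0)); rewrite fun_mxX; apply/matrixP => i j.
by rewrite !mxE /= (f2_const j j0); case: eqP.
Qed.
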